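(* Let $(X,\mathcal{U})$ be a separated uniform space, $Y$ a locally convex space quasi ordered by a nontrivial convex cone $D$, $H\subset D\setminus\{0\}$ a convex set, $f:X\to 2^Y\setminus\{\emptyset\}$ a set-valued map and $p:X\times X\to[0,+\infty)$ an r-distance. For $x\in X$ put $S(x):=\{z\in X: f(x)\subset f(z)+p(x,z)H+D\}$. Let $x_0\in X$ be such that $S(x_0)\neq\emptyset$, such that $(X,\mathcal{U})$ is $S(x_0)$-dynamically complete, and such that for any $x\in S(x_0)$, $S(x)$ is dynamically closed. Suppose that the following assumptions are satisfied: (B1) $H^{+s}\cap D^+\neq\emptyset$, or equivalently, $0\notin\mathrm{cl}(H+D)$. (B2) There exists $\xi\in H^{+s}\cap D^+$ such that $\xi$ is lower bounded on $f(S(x_0))$. Then there exists $\hat{x}\in X$ such that (a) $f(x_0)\subset f(\hat{x})+p(x_0,\hat{x})H+D$; (b) for all $x\in X\setminus\{\hat{x}\}$, $f(\hat{x})\not\subset f(x)+p(\hat{x},x)H+D$. If $p(x,x)=0$ for all $x\in X$, then $\hat{x}$ is a strict minimizer of $f(\cdot)+p(\hat{x},\cdot)H$.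
   Context: Locally convex space means real locally convex Hausdorff topological vector space. A convex cone $D\subset Y$ is a nonempty set with $D+D\subset D$ and $\alpha D\subset D$ for all $\alpha\ge0$; nontrivial means $D\ne\{0\}$, $D\neq Y$; it induces the quasi order $y_1\le_D y_2\iff y_2-y_1\in D$. Sums of sets are Minkowski sums and $f(A):=\bigcup_{x\in A}f(x)$. $Y^*$ is the topological dual, $D^+:=\{l\in Y^*: l(d)\ge0\ \forall d\in D\}$, $H^{+s}:=\{l\in Y^*:\inf_{h\in H}l(h)>0\}$. $\xi$ is lower bounded on $M\subset Y$ if $\inf_{y\in M}\xi(y)>-\infty$. r-distance: for a separated (Hausdorff) uniform space $X$, a function $p:X\times X\to[0,+\infty]$ is an r-distance on $X$ if (q1) $p(x,z)\le p(x,y)+p(y,z)$ for all $x,y,z\in X$; (q2$''$) every sequence $(y_n)\subset X$ with $p(y_n,y_m)\to0$ as $m>n\to\infty$ (i.e. for every $\delta>0$ there is $N$ with $p(y_n,y_m)<\delta$ for all $m>n\ge N$) is a Cauchy sequence in $X$; (q3) for $x,y,z\in X$, $p(z,x)=0$ and $p(z,y)=0$ imply $x=y$. $S(x)$ is dynamically closed if, whenever $(x_n)\subset S(x)$ satisfies $S(x_{n+1})\subset S(x_n)\subset S(x)$ for all $n$ and $x_n\to\bar{x}$ in $X$, then $\bar{x}\in S(x)$. $X$ is $S(x)$-dynamically complete if every Cauchy sequence $(x_n)\subset S(x)$ such that $S(x_{n+1})\subset S(x_n)\subset S(x)$ for all $n$ is convergent in $X$. A point $\hat{x}$ is a strict minimizer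 of a set-valued map $G:X\to2^Y$ (with respect to $D$) if $G(\hat{x})\not\subset G(x)+D$ for every $x\in X\setminus\{\hat{x}\}$. *)

(* Defs.v *)
From HB Require Import structures.
From mathcomp Require Import all_boot all_order all_algebra.
From mathcomp Require Import all_classical all_reals all_analysis.

Set Implicit Arguments.
Unset Strict Implicit.
Unset Printing Implicit Defensive.

Import Order.TTheory GRing.Theory Num.Theory.
Import numFieldNormedType.Exports.

Local Open Scope classical_set_scope.
Local Open Scope ring_scope.

Definition set_add (V : nmodType) (A B : set V) : set V :=
  [set a + b | a in A & b in B].

Definition set_scale (R : pzRingType) (V : lmodType R) (c : R) (A : set V) :
  set V := [set c *: a | a in A].

Declare Scope minkowski_scope.
Delimit Scope minkowski_scope with mink.
Notation "A + B" := (set_add A B) : minkowski_scope.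
Notation "c *: A" := (set_scale c A) : minkowski_scope.

Definition convex_cone (R : realType) (Y : lmodType R) (D : set Y) : Prop :=
  [/\ D !=set0,
      (D + D)%mink `<=` D &
      forall a : R, 0 <= a -> (a *: D)%mink `<=` D].

Definition nontrivial_cone (R : realType) (Y : lmodType R) (D : set Y) : Prop :=
  D <> [set 0] /\ D <> [set: Y].

Definition topological_dual (R : realType) (Y : tvsType R) :
  set {linear Y -> R^o} := [set l | continuous l].

(* D^+ *)
Definition dual_cone (R : realType) (Y : tvsType R) (D : set Y) :
    set {linear Y -> R^o} :=
  [set l | topological_dual l /\ forall d, D d -> 0 <= l d :> R].

(* H^{+s}; the infimum is taken in the extended reals, with inf(set0) = +oo *)
Definition strict_dual (R : realType) (Y : tvsType R) (H : set Y) :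
    set {linear Y -> R^o} :=
  [set l | topological_dual l /\
           (0 < ereal_inf [set (l h : R)%:E | h in H])%E].

Definition lower_bounded_on (R : realType) (Y : tvsType R)
    (xi : {linear Y -> R^o}) (M : set Y) : Prop :=
  (-oo < ereal_inf [set (xi y : R)%:E | y in M])%E.

(* Fields: nonnegativity, (q1), (q2''), (q3). *)
Record r_distance (R : realType) (X : uniformType) (p : X -> X -> \bar R) :
    Prop := RDistance {
  r_distance_ge0 : forall x y, (0 <= p x y)%E ;
  r_distance_triangle : forall x y z, (p x z <= p x y + p y z)%E ;
  r_distance_cauchy : forall u : nat -> X,
    (forall delta : R, 0 < delta ->
      exists N : nat, forall n m : nat, (N <= n)%N -> (n < m)%N ->
        (p (u n) (u m) < delta%:E)%E) ->
    cauchy (u @ \oo) ;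
  r_distance_eq : forall x y z, p z x = 0%E -> p z y = 0%E -> x = y
}.

(* The common condition on sequences in the two definitions below:
   (u_n) lies in S(x) and S(u_{n+1}) c S(u_n) c S(x) for all n. *)
Definition dynamic_seq (X : Type) (S : X -> set X) (x : X) (u : nat -> X) :
    Prop :=
  forall n, [/\ S x (u n), S (u n.+1) `<=` S (u n) & S (u n) `<=` S x].

Definition dynamically_closed (X : topologicalType) (S : X -> set X) (x : X) :
    Prop :=
  forall (u : nat -> X) (l : X), dynamic_seq S x u -> u @ \oo --> l -> S x l.

Definition dynamically_complete (X : uniformType) (S : X -> set X) (x : X) :
    Prop :=
  forall u : nat -> X, dynamic_seq S x u -> cauchy (u @ \oo) ->
    exists l : X, u @ \oo --> l.

Definition strict_minimizer (X : Type) (V : nmodType) (D : set V)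
    (G : X -> set V) (xhat : X) : Prop :=
  forall x : X, x <> xhat -> ~ (G xhat `<=` (G x + D)%mink).

Definition Sset (R : realType) (X : Type) (Y : lmodType R) (D H : set Y)
    (f : X -> set Y) (p : X -> X -> R) (x : X) : set X :=
  [set z | f x `<=` (f z + p x z *: H + D)%mink].

(* Main.v *)
(* A continuous linear form that is positive on D and bounded below by some c > 0
   on H scalarizes the problem: phi(x) = inf xi(f(x)) / c decreases by at least
   p(x, z) whenever z lies in S(x).  Successively almost minimizing phi on S(x_n)
   gives a p-Cauchy sequence whose limit l lies in every S(x_n) and satisfies
   p(l, z) = 0 for all z in S(l).  By (q3), S(l) has at most one point; since
   S(x) need not contain x, that point z (with S(z) included in S(l)), rather
   than l, is the minimizer when S(l) is nonempty.
   The equivalence in (B1) is a Hahn-Banach separation, proved by applying Zorn's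
   lemma to convex cones in Y x R, viewed as epigraphs of sublinear functions. *)

Require Import Defs.
From HB Require Import structures.
From mathcomp Require Import all_boot all_order all_algebra.
From mathcomp Require Import all_classical all_reals all_analysis.
From mathcomp Require Import ring lra.

Set Implicit Arguments.
Unset Strict Implicit.
Unset Printing Implicit Defensive.

Import Order.TTheory GRing.Theory Num.Theory.
Import numFieldNormedType.Exports.

Local Open Scope classical_set_scope.
Local Open Scope ring_scope.

(** The point [m] is the convex combination with weights [s / (s + t)] and [t / (s + t)]; when
    [s + t = 0] any point of [A] serves. *)
Lemma convex_set_scaleD (R : realType) (V : lmodType R) (A : set V)
    (s t : R) (a b : V) :
  convex_set A -> 0 <= s -> 0 <= t -> A a -> A b ->
  exists2 m, A m & s *: a + t *: b = (s + t) *: m.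
Proof.
move=> cA s0 t0 Aa Ab; have [st0|st0] := eqVneq (s + t) 0.
  exists a => //; have [-> ->] : s = 0 /\ t = 0 by split; lra.
  by rewrite !scale0r !addr0 scale0r.
have st1 : 0 <= s / (s + t) <= 1.
  have st_gt0 : 0 < s + t by rewrite lt0r st0 addr_ge0.
  by rewrite divr_ge0 ?addr_ge0//= ler_pdivrMr// mul1r lerDl.
have := cA a b (Itv01 (andP st1).1 (andP st1).2).
move=> /(_ (mem_set Aa) (mem_set Ab)); rewrite inE => Am.
eexists; first exact: Am.
rewrite /conv /= scalerDr !scalerA /unstable.onem; congr (_ *: _ + _ *: _).
  by field.
by field.
Qed.

(** * Hahn-Banach through maximal cones in [Y * R] *)

Section cone_hahn_banach.
Context {R : realType} {Y : lmodType R}.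
Implicit Types T G : set (Y * R).

(** When all fibres are nonempty, [x |-> inf {t | T (x, t)}] is sublinear; the last clause keeps it
    finite. *)
Definition epigraph_cone T : Prop :=
  [/\ forall x y s t, T (x, s) -> T (y, t) -> T (x + y, s + t),
      forall a x t, 0 <= a -> T (x, t) -> T (a *: x, a * t) &
      forall t, T (0, t) -> 0 <= t].

(** Each cone condition involves at most two points, and two points of a union along a chain lie in
    a common member. Zorn runs over the sets [A] added to [T], so that the empty chain gives [T]
    itself. *)
Lemma maximal_epigraph_cone T : epigraph_cone T ->
  exists G, [/\ T `<=` G, epigraph_cone G &
    forall G', epigraph_cone G' -> G `<=` G' -> G' `<=` G].
Proof.
move=> coneT; pose P A := epigraph_cone (T `|` A).
have [F FP totF|A [PA maxA]] := @Zorn_bigcup _ P.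
  have common z w : (T `|` \bigcup_(X in F) X) z ->
      (T `|` \bigcup_(X in F) X) w ->
    exists A, [/\ P A, A `<=` \bigcup_(X in F) X, (T `|` A) z & (T `|` A) w].
    have P0 : P set0 by rewrite /P setU0.
    move=> [Tz|[A FA Az]] [Tw|[B FB Bw]].
    - by exists set0; split => //; left.
    - by exists B; split; [exact: FP|exact: bigcup_sup|left|right].
    - by exists A; split; [exact: FP|exact: bigcup_sup|right|left].
    - have [AB|BA] := totF _ _ FA FB.
        by exists B; split; [exact: FP|exact: bigcup_sup|right; exact: AB|right].
      by exists A; split; [exact: FP|exact: bigcup_sup|right|right; exact: BA].
  have lift A : A `<=` \bigcup_(X in F) X ->
    T `|` A `<=` T `|` \bigcup_(X in F) X by move=> /setUS; exact.
  split=> [x y s t Txs Tyt|a x t a0 Txt|t Tt].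
  - have [A [[PD _ _] AF As At]] := common _ _ Txs Tyt.
    by apply: lift AF _ _; exact: PD.
  - have [A [[_ PZ _] AF At _]] := common _ _ Txt Txt.
    by apply: lift AF _ _; exact: PZ.
  - have [A [[_ _ PN] AF At _]] := common _ _ Tt Tt.
    exact: PN.
exists (T `|` A); split => //.
move=> G coneG TAG; have PG : P G.
  rewrite /P (_ : T `|` G = G)//; apply/setUidPr.
  by apply: subset_trans TAG; exact: subsetUl.
apply: contrapT => GTA; apply: (maxA G _ PG); split.
  by apply: subset_trans TAG; exact: subsetUr.
by move=> GA; apply: GTA; apply: subset_trans GA _; exact: subsetUr.
Qed.

(* The linear form is [x |-> inf {t | G (x, t)}] for a maximal cone [G]
   containing [T]; maximality puts [(- y, - inf {t | G (y, t)})] into [G]. *)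
Lemma epigraph_cone_linear T : epigraph_cone T ->
  (forall x, exists t, T (x, t)) ->
  exists l : {linear Y -> R^o}, forall x t, T (x, t) -> l x <= t :> R.
Proof.
move=> /maximal_epigraph_cone[G [TG [GD GZ GN] maxG]] Tne.
pose l x := inf [set t | G (x, t)].
have Gne x : [set t | G (x, t)] !=set0.
  by have [t Tt] := Tne x; exists t; exact: TG.
have Glb x : has_lbound [set t | G (x, t)].
  (* Adding points over [x] and [- x] gives a point over [0], hence [0 <= t + u]. *)
  have [u Gu] := Gne (- x); exists (- u) => t Gt.
  by rewrite -subr_ge0 opprK; apply: GN; rewrite -(subrr x); exact: GD.
have lG x t : G (x, t) -> l x <= t by move=> Gt; exact: (ge_inf (Glb x)).
have G00 : G (0, 0).
  have [t Gt] := Gne 0; have := GZ 0 0 t (lexx 0) Gt.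
  by rewrite scaler0 mul0r.
have lN_in y : G (- y, - l y).
  pose G' : set (Y * R) :=
    [set z | exists x t s, [/\ G (x, t), 0 <= s &
       z = (x - s *: y, t - s * l y)]].
  apply: (maxG G'); last first.
  - by exists 0, 0, 1; split => //; rewrite scale1r mul1r !sub0r.
  - move=> [x t] Gxt; exists x, t, 0; split => //.
    by rewrite scale0r mul0r !subr0.
  split.
  - move=> ? ? ? ? [x [t [s [Gt s0 [-> ->]]]]] [x' [t' [s' [Gt' s'0 [-> ->]]]]].
    exists (x + x'), (t + t'), (s + s'); split; [exact: GD|exact: addr_ge0|].
    by congr pair; [rewrite scalerDl opprD addrACA|ring].
  - move=> a ? ? a0 [x [t [s [Gt s0 [-> ->]]]]].
    exists (a *: x), (a * t), (a * s); split; [exact: GZ|exact: mulr_ge0|].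
    by congr pair; [rewrite scalerBr scalerA|ring].
  - move=> _ [x [t [s [Gt s0 [/esym/eqP + ->]]]]].
    rewrite subr_eq0 => /eqP xsy; rewrite subr_ge0.
    (* Here [x = s *: y]. For [s > 0], rescaling by [s^-1] puts [(y, t / s)] in [G], so
       [l y <= t / s]. *)
    move: s0; rewrite le_eqVlt => /predU1P[s0|s0].
      by rewrite -s0 mul0r; apply: GN; rewrite -[0](scale0r y) s0 -xsy.
    rewrite mulrC -ler_pdivlMr// mulrC; apply: lG.
    have := GZ s^-1 _ _ _ Gt; rewrite xsy scalerA mulVf ?gt_eqF// scale1r.
    by apply; rewrite invr_ge0 ltW.
have lN y : l (- y) = - l y.
  apply/eqP; rewrite eq_le (lG _ _ (lN_in y))/=.
  apply: lb_le_inf => // t Gt; rewrite lerNl; apply: lb_le_inf => // u Gu.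
  by rewrite -subr_ge0 opprK; apply: GN; rewrite -(subrr y); exact: GD.
(* The infimum is attained, so closure of [G] under sums and scaling gives subadditivity and one
   half of homogeneity; the reverse inequalities follow at opposite points. *)
have G_l y : G (y, l y) by have := lN_in (- y); rewrite lN !opprK.
have lD x y : l (x + y) = l x + l y.
  apply/eqP; rewrite eq_le (lG _ _ (GD _ _ _ _ (G_l x) (G_l y)))/=.
  by rewrite -lerN2 -lN !opprD -!lN; apply: lG; exact: GD.
have lZ_ge0 a x : 0 <= a -> l (a *: x) = a * l x.
  move=> a0; apply/eqP; rewrite eq_le (lG _ _ (GZ _ _ _ a0 (G_l x)))/=.
  rewrite -lerN2 -lN -mulrN -scalerN -lN; apply: lG; exact: GZ.
have lZ a x : l (a *: x) = a * l x.
  have [/lZ_ge0//|/ltW a0] := leP 0 a.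
  rewrite -[a]opprK scaleNr lN lZ_ge0 ?oppr_ge0//; ring.
have lin_l : linear (l : Y -> R^o) by move=> a x y; rewrite lD lZ.
pose L : {linear Y -> R^o} := HB.pack (l : Y -> R^o)
  (GRing.isLinear.Build R Y R^o _ (l : Y -> R^o) lin_l).
by exists L => x t /TG; exact: lG.
Qed.

End cone_hahn_banach.

(** * Neighborhoods of [0] and continuity of linear forms *)

Lemma tvs_convex_nbhs (R : numDomainType) (Y : tvsType R) (N : set Y) (x : Y) :
  nbhs x N -> exists V, [/\ nbhs x V, convex_set V & V `<=` N].
Proof.
have [B Bconvex [Bopen Bbasis]] := @locally_convex R Y.
move=> /(Bbasis x)[V [BV Vx] VN]; exists V; split => //.
  by apply: open_nbhs_nbhs; split => //; exact: Bopen.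
by apply: Bconvex; exact: mem_set.
Qed.

Lemma nbhs0_absorbing (R : realType) (Y : tvsType R) (V : set Y) (x : Y) :
  nbhs 0 V -> exists2 a : R, 0 < a & V (a *: x).
Proof.
move=> V0; have := @scale_continuous R Y (0, x) V.
rewrite /= scale0r => /(_ V0)[[B1 B2]/= [B10 B2x] BV].
have [e /= e0 eB1] := B10.
exists (e / 2); first exact: divr_gt0.
apply: (BV (e / 2, x)); split; last exact: nbhs_singleton.
by apply: eB1; rewrite /ball_ /= sub0r normrN gtr0_norm ?divr_gt0//; lra.
Qed.

(** On the symmetric neighborhood [V] intersected with [- V] the form is at most 1 in absolute
    value; scaling by [e] and translating by [x] gives continuity at [x]. *)
Lemma linear_bounded_above_continuous (R : realType) (Y : tvsType R)
    (l : {linear Y -> R^o}) (V : set Y) :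
  nbhs 0 V -> (forall v, V v -> l v <= 1 :> R) -> continuous l.
Proof.
move=> V0 lV1 x; apply/cvgrPdist_le => /= e e0.
pose W := V `&` (-%R @` V).
have W0 : nbhs 0 W by apply: filterI => //; exact: nbhs0N.
have := nbhsT x (nbhs0Z (lt0r_neq0 e0) W0).
apply: filterS => _ [_ [v [Vv [w Vw wv]] <-] <-].
rewrite linearD linearZ /= opprD addrA subrr sub0r normrN normrM gtr0_norm//.
rewrite -[leRHS]mulr1 ler_pM2l// ler_norml lV1// andbT.
by rewrite -wv linearN lerN2 lV1.
Qed.

(** * Strictly positive forms and separation of [0] from [H + D] *)

Lemma strict_dualP (R : realType) (Y : tvsType R) (H : set Y)
    (l : {linear Y -> R^o}) :
  strict_dual H l <->
  continuous l /\ exists2 c : R, 0 < c & forall h, H h -> c <= l h.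
Proof.
split=> -[lc]; last first.
  move=> [c c0 cl]; split => //.
  apply: (@lt_le_trans _ _ c%:E); first by rewrite lte_fin.
  by apply: le_ereal_inf_tmp => _ [h Hh <-]; rewrite lee_fin cl.
move=> inf0; split => //.
have lb h : H h -> (ereal_inf [set (l h : R)%:E | h in H] <= (l h)%:E)%E.
  by move=> Hh; apply: ereal_inf_lbound; exists h.
move: inf0 lb; case: (ereal_inf _) => [c c0 lb| _ lb|//].
  by exists c => // h /lb; rewrite lee_fin.
(* An infimum [+oo] forces [H] to be empty, so any positive constant works. *)
by exists 1 => // h /lb; rewrite leye_eq.
Qed.

(** For [c > 0] bounding [l] below on [H], also [l >= c] on [H + D], while [l < c] defines a
    neighborhood of [0]. *)
Lemma strict_dual_cone_not_closure (R : realType) (Y : tvsType R)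
    (D H : set Y) (l : {linear Y -> R^o}) :
  strict_dual H l -> dual_cone D l -> ~ closure (H + D)%mink 0.
Proof.
move=> /strict_dualP[lc [c c0 cl]] [_ lD] /(_ [set y | l y < c]).
have cnbhs : nbhs 0 [set y | l y < c].
  by apply: (lc 0 [set r : R | r < c]); rewrite linear0; exact: lt_nbhsl.
move=> /(_ cnbhs)[_ [[h Hh [d Dd <-]]]] /=; apply/negP; rewrite -leNgt linearD.
by rewrite -[leLHS]addr0; apply: lerD; [exact: cl|exact: lD].
Qed.

(* For a convex neighborhood [V] of [0] disjoint from [H + D], the cone [T] is the
   epigraph of the sublinear function [x |-> inf (gauge V (x + s h + d) - s)]
   over [s >= 0], [h] in [H] and [d] in [D]. *)
Lemma convex_cone_separation (R : realType) (Y : tvsType R) (D H : set Y) :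
  convex_cone D -> convex_set H -> ~ closure (H + D)%mink 0 ->
  strict_dual H `&` dual_cone D !=set0.
Proof.
move=> [[d0 Dd0] DD DZ] cH ncl.
have D_add d d' : D d -> D d' -> D (d + d').
  by move=> Dd Dd'; apply: DD; exists d => //; exists d'.
have D_scale a d : 0 <= a -> D d -> D (a *: d).
  by move=> a0 Dd; apply: (DZ a) => //; exists d.
have D0 : D 0 by rewrite -(scale0r d0); exact: D_scale.
have [H0|/set0P[h0 Hh0]] := eqVneq H set0.
  exists (\0 : {linear Y -> R^o}); split.
    apply/strict_dualP; split; first exact: cst_continuous.
    by exists 1 => // h; rewrite H0.
  by split; first exact: cst_continuous.
have [N [N0 HDN]] : exists N, nbhs 0 N /\ forall h d, H h -> D d -> ~ N (h + d).
  apply: contrapT => nN; apply: ncl => N N0; apply: contrapT => HDN.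
  apply: nN; exists N; split => // h d Hh Dd Nhd; apply: HDN.
  by exists (h + d); split => //; exists h => //; exists d.
have [V [V0 cV VN]] := tvs_convex_nbhs N0.
have Vz : V 0 := nbhs_singleton V0.
pose T : set (Y * R) := [set z | exists x r s v h d,
  [/\ 0 <= r, 0 <= s & [/\ V v, H h & D d]] /\
  (x + s *: h + d = r *: v /\ z = (x, r - s))].
have coneT : epigraph_cone T.
  split.
  - move=> ? ? ? ? [x [r [s [v [h [d [[r0 s0 [Vv Hh Dd]] [xE [-> ->]]]]]]]]].
    move=> [x' [r' [s' [v' [h' [d' [[r'0 s'0 [Vv' Hh' Dd']] [xE' [-> ->]]]]]]]]].
    have [w Vw wE] := convex_set_scaleD cV r0 r'0 Vv Vv'.
    have [k Hk kE] := convex_set_scaleD cH s0 s'0 Hh Hh'.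
    exists (x + x'), (r + r'), (s + s'), w, k, (d + d').
    split; first by split; [exact: addr_ge0..|split => //; exact: D_add].
    split; last by congr pair; ring.
    by rewrite -wE -kE -xE -xE' (addrACA x) [LHS]addrACA.
  - move=> a ? ? a0 [x [r [s [v [h [d [[r0 s0 [Vv Hh Dd]] [xE [-> ->]]]]]]]]].
    exists (a *: x), (a * r), (a * s), v, h, (a *: d).
    split; first by split; [exact: mulr_ge0..|split => //; exact: D_scale].
    by rewrite -!scalerA -xE !scalerDr mulrBr.
  (* If [r < s], then [h + s^-1 *: d = (r / s) *: v] lies in [V] by convexity and [0] in [V],
     against disjointness from [H + D]. *)
  - move=> _ [x [r [s [v [h [d [[r0 s0 [Vv Hh Dd]] [xE [x0 ->]]]]]]]]].
    move: xE; rewrite -x0 add0r => hdE; rewrite leNgt subr_lt0; apply/negP => rs.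
    have s_gt0 : 0 < s by exact: le_lt_trans rs.
    apply: (HDN h (s^-1 *: d)) => //.
      by apply: D_scale => //; rewrite invr_ge0.
    apply: VN.
    have -> : h + s^-1 *: d = (s^-1 * r) *: v.
      by rewrite -scalerA -hdE scalerDr scalerA mulVf ?gt_eqF// scale1r.
    have a0 : 0 <= s^-1 * r by rewrite mulr_ge0 ?invr_ge0.
    have a1 : 0 <= 1 - s^-1 * r.
      by rewrite subr_ge0 mulrC ler_pdivrMr// mul1r ltW.
    have [w Vw] := convex_set_scaleD cV a0 a1 Vv Vz.
    by rewrite scaler0 addr0 addrC subrK scale1r => ->.
have [x|l lT] := epigraph_cone_linear coneT.
  have [a a0 Vax] := nbhs0_absorbing x V0.
  exists (a^-1 - 0), x, a^-1, 0, (a *: x), h0, 0.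
  split; first by split => //; rewrite invr_ge0 ltW.
  by rewrite scale0r !addr0 scalerA mulVf ?gt_eqF// scale1r.
(* The points [(v, 1)], [(- h, - 1)] and [(- d, 0)] of [T] give in turn [l <= 1] on [V], [l >= 1] on
   [H] and [l >= 0] on [D]. *)
have lV v : V v -> l v <= 1 :> R.
  move=> Vv; apply: lT; exists v, 1, 0, v, h0, 0; split => //.
  by rewrite scale0r !addr0 scale1r subr0.
have lc := linear_bounded_above_continuous V0 lV.
exists l; split.
  apply/strict_dualP; split => //; exists 1 => // h Hh.
  rewrite -lerN2 -linearN; apply: lT; exists (- h), 0, 1, 0, h, 0; split => //.
  by rewrite scale1r addNr scaler0 addr0 sub0r.
split => // d Dd; rewrite -oppr_le0 -linearN; apply: lT.
exists (- d), 0, 0, 0, h0, d; split => //.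
by rewrite !scale0r addr0 addNr subr0.
Qed.

(** * Variational principle for a transitive relation with a scalar potential *)

Lemma dynamic_ekeland (R : realType) (X : uniformType) (S : X -> set X)
    (p : X -> X -> R) (phi : X -> R) (m : R) (x0 : X) :
  r_distance (fun x y => (p x y)%:E) ->
  (forall x z, S x z -> S z `<=` S x) ->
  S x0 !=set0 ->
  dynamically_complete S x0 ->
  (forall x, S x0 x -> dynamically_closed S x) ->
  (forall x, S x0 x -> m <= phi x) ->
  (forall x z, S x0 x -> S x z -> p x z <= phi x - phi z) ->
  exists2 y, S x0 y & forall x, S y x -> x = y.
Proof.
move=> rp Strans [x1 Sx1] complete closed phi_ge p_le.
have p_ge0 x y : 0 <= p x y by rewrite -lee_fin; exact: (r_distance_ge0 rp).
apply: contrapT => noy.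
(* A point with empty [S x] would satisfy the conclusion vacuously. *)
have Sne x : S x0 x -> S x !=set0.
  move=> Sx; apply: contrapT => Sx0; apply: noy; exists x => // z Sxz.
  by exfalso; apply: Sx0; exists z.
have step (nx : nat * X) : exists z, S x0 nx.2 ->
    S nx.2 z /\ forall w, S nx.2 w -> phi z <= phi w + nx.1.+1%:R^-1.
  case: nx => n x /=; have [Sx|nSx] := pselect (S x0 x); last by exists x.
  have infS : has_inf [set phi z | z in S x].
    split; first by have [z Sz] := Sne _ Sx; exists (phi z), z.
    by exists m => _ [z Sz <-]; apply: phi_ge; exact: Strans Sx _ Sz.
  have n0 : 0 < n.+1%:R^-1 :> R by rewrite invr_gt0.
  have [_ [z Sz <-] zlt] := inf_adherent n0 infS.
  exists z => _; split => // w Sw; apply: (le_trans (ltW zlt)).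
  by rewrite lerD2r; apply: (ge_inf infS.2); exists w.
have [g gP] := choice step.
(* The sequence starts at [x1], since [x0] may lie outside [S x0]. *)
pose fix u n := if n is k.+1 then g (k, u k) else x1.
have Su n : S x0 (u n).
  by elim: n => [//|n IH]; apply: Strans (IH) _ _; exact: (gP (n, u n) IH).1.
have Suu n : S (u n) (u n.+1) := (gP (n, u n) (Su n)).1.
have umin n w : S (u n) w -> phi (u n.+1) <= phi w + n.+1%:R^-1 :=
  (gP (n, u n) (Su n)).2 w.
have Slt n k : S (u n) (u (k + n.+1)%N).
  elim: k => [|k IH]; first exact: Suu.
  exact: Strans IH _ (Suu _).
have u_cauchy : cauchy (u @ \oo).
  apply: (r_distance_cauchy rp) => e e0.
  have [N _ Ne] := near_infty_natSinv_lt (PosNum e0).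
  (* Starting at [N.+1] makes the smaller index a successor: [u n.+1] minimizes [phi] on [S (u n)],
     which contains [u k], up to [n.+1%:R^-1]. *)
  exists N.+1 => -[//|n] k Nn nk; rewrite lte_fin.
  have Snk j : (j < k)%N -> S (u j) (u k).
    by move=> jk; rewrite -(subnK jk); exact: Slt.
  apply: le_lt_trans (Ne n Nn); apply: le_trans (p_le _ _ (Su _) (Snk _ nk)) _.
  by rewrite lerBlDl; apply: umin; apply: Snk; exact: ltnW.
have [|l ul] := complete u _ u_cauchy.
  by move=> n; split; [exact: Su|exact: Strans|exact: Strans].
have Sl n : S (u n) l.
  (* Only the tail past [n] is known to lie in [S (u n)]. *)
  apply: (closed _ (Su n) (fun k => u (k + n.+1)%N)).
    move=> k; split; [exact: Slt| |exact: Strans].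
    by apply: Strans; rewrite addSn; exact: Suu.
  by apply: cvg_comp ul; exact: cvg_addnr.
have Sx0l : S x0 l := Strans _ _ Sx1 _ (Sl 0%N).
have pl0 z : S l z -> p l z = 0.
  move=> Slz; apply/le_anti; rewrite p_ge0 andbT.
  (* Since [z] also lies in [S (u N)], [phi l <= phi (u N.+1) <= phi z + N.+1%:R^-1]. *)
  apply: le_trans (p_le _ _ Sx0l Slz) _; rewrite subr_le0.
  apply/ler_addgt0Pr => e e0.
  have [N _ Ne] := near_infty_natSinv_lt (PosNum e0).
  have eN : N.+1%:R^-1 < e := Ne N (leqnn N).
  have phil : 0 <= phi (u N.+1) - phi l.
    exact: le_trans (p_ge0 _ _) (p_le _ _ (Su N.+1) (Sl N.+1)).
  have phiu := umin N z (Strans _ _ (Sl N) _ Slz).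
  move: eN phil phiu; rewrite subr_ge0 => eN phil phiu.
  by apply: (le_trans phil); apply: (le_trans phiu); rewrite lerD2l ltW.
have [z Slz] := Sne _ Sx0l; apply: noy; exists z => [|w Szw].
  exact: Strans Sx0l _ Slz.
have plw : p l w = 0 by apply: pl0; exact: Strans Slz _ Szw.
by apply: (r_distance_eq rp (z := l)); rewrite ?plw ?pl0.
Qed.

(** * Transitivity and scalarization of the sets [S(x)] *)

Section Sset_theory.
Context {R : realType} {X : uniformType} {Y : tvsType R}.
Variables (D H : set Y) (f : X -> set Y) (p : X -> X -> R).
Hypotheses (coneD : convex_cone D) (convexH : convex_set H).
Hypotheses (HD : H `<=` D) (rp : r_distance (fun x y => (p x y)%:E)).

Lemma SsetP x z : Sset D H f p x z <-> forall y, f x y ->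
  exists y' h d, [/\ f z y', H h, D d & y = y' + p x z *: h + d].
Proof.
split=> [Sxz y /Sxz|Sxz y /Sxz].
  by move=> [_ [y' fy' [_ [h Hh <-] <-]] [d Dd <-]]; exists y', h, d.
move=> [y' [h [d [fy' Hh Dd ->]]]]; exists (y' + p x z *: h).
  by exists y' => //; exists (p x z *: h) => //; exists h.
by exists d.
Qed.

(* [p x z H + p z w H] lies in [(p x z + p z w) H] by convexity of [H], and the
   excess [(p x z + p z w - p x w) H] is absorbed by [D]. *)
Lemma Sset_trans x z : Sset D H f p x z -> Sset D H f p z `<=` Sset D H f p x.
Proof.
move=> /SsetP Sxz w /SsetP Szw; apply/SsetP => y /Sxz.
move=> [_ [h [d [/Szw[y' [h' [d' [fy' Hh' Dd' ->]]]] Hh Dd ->]]]].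
have p_ge0 a b : 0 <= p a b by rewrite -lee_fin; exact: (r_distance_ge0 rp).
have [k Hk kE] := convex_set_scaleD convexH (p_ge0 z w) (p_ge0 x z) Hh' Hh.
have [_ DD DZ] := coneD.
exists y', k, ((p x z + p z w - p x w) *: k + (d' + d)); split => //.
  apply: (DD); exists ((p x z + p z w - p x w) *: k).
    apply: (DZ (p x z + p z w - p x w)); last by exists k => //; exact: HD.
    by rewrite subr_ge0 -lee_fin EFinD; exact: (r_distance_triangle rp).
  by exists (d' + d) => //; apply: DD; exists d' => //; exists d.
rewrite -!addrA; congr (y' + _); rewrite (addrCA d') !addrA kE -scalerDl.
by congr (_ *: _ + _ + _); ring.
Qed.

(** Apply [xi] to [y = y' + p x z *: h + d] and take the infimum over [y]. The bound on [f z] makes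
    the real [inf] there a genuine lower bound rather than a default value. *)
Lemma Sset_inf_le (xi : {linear Y -> R^o}) (c : R) x z :
  dual_cone D xi -> (forall h, H h -> c <= xi h :> R) -> f x !=set0 ->
  has_lbound [set (xi y : R) | y in f z] -> Sset D H f p x z ->
  inf [set (xi y : R) | y in f z] + p x z * c <=
  inf [set (xi y : R) | y in f x].
Proof.
move=> [_ xiD] cxi [y0 fy0] lbz /SsetP Sxz.
apply: lb_le_inf => [|_ [y /Sxz[y' [h [d [fy' Hh Dd ->]]]] <-]].
  by exists (xi y0), y0.
rewrite !linearD linearZ /= -[leLHS]addr0; apply: lerD; last exact: xiD.
apply: lerD; first by apply: (ge_inf lbz); exists y'.
by apply: ler_wpM2l; [rewrite -lee_fin; exact: (r_distance_ge0 rp)|exact: cxi].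
Qed.

End Sset_theory.

Theorem theorem4p2 (R : realType) (X : uniformType) (Y : tvsType R)
    (D H : set Y) (f : X -> set Y) (p : X -> X -> R) (x0 : X)
    (hausX : hausdorff_space X) (hausY : hausdorff_space Y)
    (coneD : convex_cone D) (ntD : nontrivial_cone D)
    (HD : H `<=` D `\ 0) (convexH : convex_set H)
    (fN0 : forall x, f x !=set0)
    (rp : r_distance (fun x y => (p x y)%:E))
    (Sx0 : Sset D H f p x0 !=set0)
    (completeX : dynamically_complete (Sset D H f p) x0)
    (closedS : forall x, Sset D H f p x0 x ->
       dynamically_closed (Sset D H f p) x) :
  (strict_dual H `&` dual_cone D !=set0 <-> ~ closure (H + D)%mink 0)
  /\
  (strict_dual H `&` dual_cone D !=set0 ->
   (exists2 xi, (strict_dual H `&` dual_cone D) xi &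
      lower_bounded_on xi (\bigcup_(x in Sset D H f p x0) f x)) ->
   exists xhat : X,
     [/\ f x0 `<=` (f xhat + p x0 xhat *: H + D)%mink,
         (forall x, x <> xhat ->
            ~ (f xhat `<=` (f x + p xhat x *: H + D)%mink)) &
         (forall x, p x x = 0) ->
            strict_minimizer D (fun x => f x + p xhat x *: H)%mink xhat]).
Proof.
split.
  split=> [[l [lH lD]]|]; first exact: strict_dual_cone_not_closure lH lD.
  exact: convex_cone_separation.
move=> _ [xi [/strict_dualP[_ [c c0 cxi]] xiD] xi_bounded].
have HsubD : H `<=` D by move=> h /HD[].
have [m m_le] : exists m : R, forall x y,
    Sset D H f p x0 x -> f x y -> m <= xi y.
  move: xi_bounded; rewrite /lower_bounded_on => bounded.
  have lb x y : Sset D H f p x0 x -> f x y -> (ereal_inf [set (xi y : R)%:E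
      | y in \bigcup_(x in Sset D H f p x0) f x] <= (xi y)%:E)%E.
    by move=> Sx fy; apply: ereal_inf_lbound; exists y => //; exists x.
  move: bounded lb; case: (ereal_inf _) => [m _ lb|_ lb|//].
    by exists m => x y Sx /(lb _ _ Sx); rewrite lee_fin.
  by exists 0 => x y Sx /(lb _ _ Sx); rewrite leye_eq.
have Strans := Sset_trans (f := f) coneD convexH HsubD rp.
(* Dividing by [c] normalizes the decrease to at least [p x z]. *)
pose phi x := inf [set (xi y : R) | y in f x] / c.
have [||xhat Sxhat Shat] := dynamic_ekeland (phi := phi) (m := m / c) rp Strans
    Sx0 completeX closedS.
- move=> x Sx; rewrite ler_pM2r ?invr_gt0//; apply: lb_le_inf.
    by have [y fy] := fN0 x; exists (xi y), y.
  by move=> _ [y fy <-]; exact: m_le Sx fy.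
- move=> x z Sx Sxz; rewrite -mulrBl ler_pdivlMr// lerBrDl.
  apply: (Sset_inf_le rp xiD cxi (fN0 x)) => //.
  by exists m => _ [y fy <-]; exact: m_le (Strans _ _ Sx _ Sxz) fy.
have not_dominated x :
    x <> xhat -> ~ (f xhat `<=` (f x + p xhat x *: H + D)%mink).
  by move=> xxhat /Shat.
exists xhat; split => // pxx x /not_dominated ndom Gx; apply: ndom.
apply: subset_trans Gx => y fy.
(* A point of [H] is needed for [f xhat] to lie in [f xhat + 0 *: H]; one comes from decomposing an
   element of [f x0] along a point of [S(x0)]. *)
have [h Hh] : H !=set0.
  have [z /SsetP Sz] := Sx0; have [y0 /Sz[_ [h [_ [_ Hh _ _]]]]] := fN0 x0.
  by exists h.
exists y => //; exists (p xhat xhat *: h); first by exists h.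
by rewrite pxx scale0r addr0.
Qed.
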